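(* Let $f$ be an analytic function on a neighborhood of the unit circle $\{|z|=1\}$ such that $f(z)>0$ for all $|z|=1$. Let $\mathcal{D}_m=\{z\in\mathbb{C}:z^m=1\}$. Then there is a positive constant $c$ such that $$\mathbf{T}_n(f,\mathcal{D}_m)=\mathcal{T}_n(f)\left(1+O(e^{-c(m-n)})\right)$$ as $m-n\to\infty$ and $n\to\infty$.
   Context: The discrete Toeplitz determinant is $\mathbf{T}_n(f,\mathcal{D})=\det\Big[\frac1{|\mathcal{D}|}\sum_{z\in\mathcal{D}}z^{-j+k}f(z)\Big]_{j,k=0}^{n-1}$ for a finite subset $\mathcal{D}$ of the unit circle, and the continuous Toeplitz determinant is $\mathcal{T}_n(f)=\det\Big[\int_{|z|=1}z^{-j+k}f(z)\frac{dz}{2\pi i z}\Big]_{j,k=0}^{n-1}$. The function $f$ is fixed (independent of $n$ and $m$). *)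

(* Defs.v *)
From HB Require Import structures.
From mathcomp Require Import all_boot all_order all_algebra finmap.
From mathcomp Require Import complex.
From mathcomp Require Import all_classical all_reals all_analysis.

Set Implicit Arguments.
Unset Strict Implicit.
Unset Printing Implicit Defensive.

Import Order.TTheory GRing.Theory Num.Theory.
Import numFieldNormedType.Exports.

Local Open Scope classical_set_scope.
Local Open Scope ring_scope.
Local Open Scope complex_scope.

(* The order on R[i] is partial: [0 < r] says that r is a positive real. *)
Definition analytic_at (R : realType) (f : R[i] -> R[i]) (a : R[i]) : Prop :=
  exists (u : nat -> R[i]) (r : R[i]), 0 < r /\
    forall z : R[i], `|z - a| < r ->
      series (fun k => u k * (z - a) ^+ k : (R[i] : numFieldType)) @ \oo
        --> (f z : (R[i] : numFieldType)).

Definition unit_circle (R : realType) : set R[i] := [set z | `|z| = 1].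

Definition analytic_near (R : realType) (f : R[i] -> R[i]) (A : set R[i]) : Prop :=
  exists U : set (R[i] : numFieldType),
    [/\ open U, A `<=` U & forall a, U a -> analytic_at f a].

Definition cexpi (R : realType) (t : R) : R[i] := cos t +i* sin t.

(* Integral of a complex-valued function of a real variable on [a, b]. *)
Definition cintegral (R : realType) (a b : R) (g : R -> R[i]) : R[i] :=
  (\int[lebesgue_measure]_(t in `[a, b]) complex.Re (g t))
  +i* (\int[lebesgue_measure]_(t in `[a, b]) complex.Im (g t)).

(* Contour integral of g(z) dz along z = e^(it), 0 <= t <= 2 pi,
   so that dz = i e^(it) dt. *)
Definition circle_integral (R : realType) (g : R[i] -> R[i]) : R[i] :=
  cintegral 0 (2 * pi) (fun t => g (cexpi t) * ((0 +i* 1) * cexpi t)).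

(* Meaningful for finite nonempty D only; exponents are in int. *)
Definition discrete_toeplitz (R : realType) (n : nat) (f : R[i] -> R[i])
    (D : set R[i]) : R[i] :=
  \det (\matrix_(j < n, k < n)
    ((#|` fset_set D|)%:R^-1 * \sum_(z \in D) z ^ (- j%:Z + k%:Z) * f z)).

Definition toeplitz (R : realType) (n : nat) (f : R[i] -> R[i]) : R[i] :=
  \det (\matrix_(j < n, k < n)
    circle_integral
      (fun z => z ^ (- j%:Z + k%:Z) * f z / (2 * (pi : R)%:C * (0 +i* 1) * z))).

Definition unity_roots (R : realType) (m : nat) : set R[i] :=
  [set z | z ^+ m = 1].

(* Main.v *)
Require Import Defs.
From mathcomp Require Import all_boot all_order all_algebra.
From mathcomp Require Import complex.
From mathcomp Require Import all_classical all_reals all_analysis.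
From mathcomp Require Import ring lra zify.

(** Write [c_d] for the Fourier coefficients of [f] and [dft m f d] for their discretisation on
the [m]-th roots of unity. The discretised coefficients decay exponentially, uniformly in [m]:
near each point of the circle [f] is, up to an error [O(8^-k)], a polynomial of degree less than
[k], and such polynomials are annihilated by the product over [i < k] of the operators
[g |-> g (w * _) - w ^+ i * g] with [w] a root of unity; on the frequency [d] this product acts
as multiplication by a number of modulus at least 1 when [w] is a rotation by a suitable angle
of order [1/d] and [k] is a small multiple of [d]. Aliasing expresses [dft m f d] as the sum of
the [dft (m * L) f (d + m * p)], and letting [L] tend to infinity gives
[|c_d - dft m f d| = O(rho^(m - |d|))].

Hence the two Toeplitz matrices differ by a matrix whose entries sum to [O(rho^(m - n))]. The
discrete one has smallest eigenvalue at least [mu = min f], by Parseval on the roots of unity,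
and changing one entry of a matrix [T] by [e] multiplies its determinant by
[1 + e * (T^-1)_kj], where the entries of [T^-1] are bounded by [1/mu]; so the perturbation is
carried out one entry at a time. *)

Import Order.TTheory GRing.Theory Num.Theory.
Import numFieldNormedType.Exports.
Local Open Scope ring_scope.
Local Open Scope complex_scope.

Set Implicit Arguments.
Unset Strict Implicit.

Section Modulus.
Variable R : realType.
Implicit Types (x y z : R[i]) (a b t : R).

Definition cabs z : R := ComplexField.Normc.normc z.

Lemma normcabs z : `|z| = (cabs z)%:C.
Proof. by []. Qed.

Lemma cabs0 : cabs 0 = 0.
Proof. exact: ComplexField.Normc.normc0. Qed.

Lemma cabs1 : cabs 1 = 1.
Proof. exact: ComplexField.Normc.normc1. Qed.

Lemma cabsM x y : cabs (x * y) = cabs x * cabs y.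
Proof. exact: ComplexField.Normc.normcM. Qed.

Lemma cabsV x : cabs x^-1 = (cabs x)^-1.
Proof. exact: ComplexField.Normc.normcV. Qed.

Lemma cabsD x y : cabs (x + y) <= cabs x + cabs y.
Proof. exact: le_normcD. Qed.

Lemma cabsN x : cabs (- x) = cabs x.
Proof. exact: normcN. Qed.

Lemma cabs_ge0 x : 0 <= cabs x.
Proof. by rewrite -lecR -normcabs normr_ge0. Qed.

Lemma cabs_eq0 x : (cabs x == 0) = (x == 0).
Proof. by rewrite -[RHS]normr_eq0 normcabs eq_complex /= eqxx andbT. Qed.

Lemma cabs_gt0 x : (0 < cabs x) = (x != 0).
Proof. by rewrite lt_def cabs_eq0 cabs_ge0 andbT. Qed.

Lemma cabsB_ge x y : cabs x - cabs y <= cabs (x + y).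
Proof. by rewrite lerBlDr -(cabsN y) (le_trans _ (cabsD _ _)) // addrK. Qed.

Lemma cabsX x n : cabs (x ^+ n) = cabs x ^+ n.
Proof. by elim: n => [|n IH]; rewrite ?expr0 ?cabs1 // !exprS cabsM IH. Qed.

Lemma cabs_real a : cabs a%:C = `|a|.
Proof. by rewrite /cabs /= expr0n addr0 sqrtr_sqr. Qed.

Lemma cabs_nat n : cabs n%:R = n%:R.
Proof. by rewrite -(rmorph_nat (real_complex R)) cabs_real normr_nat. Qed.

Lemma cabs_conj x : cabs x^* = cabs x.
Proof. by apply: complexI; rewrite -!normcabs normcJ. Qed.

Lemma cabs_sum (I : Type) (s : seq I) (P : pred I) (F : I -> R[i]) :
  cabs (\sum_(i <- s | P i) F i) <= \sum_(i <- s | P i) cabs (F i).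
Proof.
elim/big_ind2 : _ => [|x a y b xa yb|i _]; first by rewrite cabs0.
  by rewrite (le_trans (cabsD _ _)) ?lerD.
by [].
Qed.

Lemma cabs_prod (I : Type) (s : seq I) (P : pred I) (F : I -> R[i]) :
  cabs (\prod_(i <- s | P i) F i) = \prod_(i <- s | P i) cabs (F i).
Proof.
by elim/big_ind2 : _ => [|x a y b <- <-|i _]; rewrite ?cabs1 ?cabsM.
Qed.

Lemma cabs_sqr z : (cabs z ^+ 2)%:C = z * z^*.
Proof. by rewrite rmorphXn /= -normcabs sqr_normc. Qed.

Lemma cabs_Re z : `|complex.Re z| <= cabs z.
Proof. by rewrite -lecR normc_ge_Re. Qed.

Lemma sqr_cabs z : cabs z ^+ 2 = complex.Re z ^+ 2 + complex.Im z ^+ 2.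
Proof. by apply: complexI; rewrite add_Re2_Im2 normcabs rmorphXn. Qed.

End Modulus.

Section Determinant.
Variable R : realType.
Local Notation C := R[i].
Variable n : nat.
Implicit Types (T E : 'M[C]_n) (v : 'rV[C]_n).

Definition coercive (nu : R) T :=
  forall v, nu * \sum_i cabs (v 0 i) ^+ 2 <=
    cabs (\sum_k (v *m T) 0 k * (v 0 k)^*).

Lemma sqnorm_ge v i : cabs (v 0 i) ^+ 2 <= \sum_i cabs (v 0 i) ^+ 2.
Proof. by rewrite (bigD1 i) //= lerDl sumr_ge0 // => j _; rewrite sqr_ge0. Qed.

Lemma coercive_unitmx nu T : 0 < nu -> coercive nu T -> T \in unitmx.
Proof.
move=> nu0 cT; rewrite unitmxE unitfE; apply/negP => /det0P[v v0 vT].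
move: (cT v); rewrite vT [X in cabs X]big1 => [|k _]; last by rewrite mxE mul0r.
rewrite cabs0 pmulr_rle0 // => S0; case/negP: v0; apply/eqP/rowP => i.
apply/eqP; rewrite mxE -cabs_eq0 -sqrf_eq0.
by rewrite eq_le sqr_ge0 andbT (le_trans (sqnorm_ge v i)).
Qed.

Lemma coercive_invmx nu T : 0 < nu -> coercive nu T ->
  forall j k, cabs (invmx T j k) <= nu^-1.
Proof.
move=> nu0 cT j k; have Tu := coercive_unitmx nu0 cT.
have := cT (row j (invmx T)).
rewrite -row_mul mulVmx // [X in cabs X](bigD1 j) //= [X in cabs (_ + X)]big1
  ?addr0 => [|i ij]; last first.
  by rewrite !mxE eq_sym (negbTE ij) mul0r.
rewrite !mxE eqxx mul1r cabs_conj.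
have /[!mxE] := sqnorm_ge (row j (invmx T)) j.
have /[!mxE] := sqnorm_ge (row j (invmx T)) k.
move: (\sum_i _) (cabs_ge0 (invmx T j j)) (cabs_ge0 (invmx T j k)) => S.
move: (cabs (invmx T j j)) (cabs (invmx T j k)) => a b a0 b0 bS aS nuS.
have nua : nu * a <= 1.
  have [->|an0] := eqVneq a 0; first by rewrite mulr0.
  have {an0}a0 : 0 < a by rewrite lt_def an0.
  by rewrite -(ler_pM2r a0) mul1r (le_trans _ nuS) // -mulrA ler_pM2l // -expr2.
have nub : (nu * b) ^+ 2 <= 1.
  rewrite (le_trans _ nua) // exprMn expr2 -mulrA ler_pM2l //.
  by rewrite (le_trans _ nuS) // ler_pM2l.
rewrite -[leRHS]mul1r ler_pdivlMr // mulrC -(@ler_pXn2r _ 2) ?nnegrE ?mulr_ge0 //.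
- by rewrite expr1n.
- exact: ltW.
Qed.

Lemma coerciveD nu T j k (e : C) : coercive nu T ->
  coercive (nu - cabs e) (T + e *: delta_mx j k).
Proof.
move=> cT v; rewrite mulmxDr -scalemxAr.
have -> : \sum_i (v *m T + e *: (v *m delta_mx j k)) 0 i * (v 0 i)^*
   = \sum_i (v *m T) 0 i * (v 0 i)^* + e * v 0 j * (v 0 k)^*.
  under eq_bigr do rewrite !mxE mulrDl.
  rewrite big_split /=; congr (_ + _).
    by apply: eq_bigr => i _; rewrite !mxE.
  rewrite (bigD1 k) //= [X in _ + X]big1 => [|i ik]; last first.
    by rewrite big1 ?mulr0 ?mul0r // => l _; rewrite mxE (negbTE ik) andbF mulr0.
  rewrite addr0 (bigD1 j) //= big1 => [|l lj]; last first.
    by rewrite mxE (negbTE lj) mulr0.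
  by rewrite mxE !eqxx mulr1 addr0.
apply: le_trans (cabsB_ge _ _); rewrite mulrBl lerB //.
rewrite !cabsM cabs_conj -mulrA ler_wpM2l ?cabs_ge0 //.
have := sqnorm_ge v j; have := sqnorm_ge v k.
move: (cabs _) (cabs _) (\sum_i _) => a b S; nra.
Qed.

Lemma det_delta T j k (e : C) : T \in unitmx ->
  \det (T + e *: delta_mx j k) = \det T * (1 + e * invmx T k j).
Proof.
move=> Tu; have dT : \det T != 0 by rewrite -unitfE -unitmxE.
have cofE l : cofactor (T + e *: delta_mx j k) j l = cofactor T j l.
  rewrite /cofactor; congr (_ * \det _); apply/matrixP => a b.
  by rewrite !mxE eq_sym (negbTE (neq_lift _ _)) mulr0 addr0.
rewrite (expand_det_row _ j).
under eq_bigr do rewrite cofE !mxE eqxx mulrDl /=.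
rewrite big_split /= -expand_det_row mulrDr mulr1; congr (_ + _).
rewrite (bigD1 k) //= big1 => [|i /negbTE ik]; last by rewrite ik mulr0 mul0r.
rewrite eqxx mulr1 addr0 /invmx Tu !mxE; set c := cofactor _ _ _.
by rewrite [RHS]mulrCA mulVKf.
Qed.

Lemma det_perturb_seq (nu0 : R) (s : seq ('I_n * 'I_n * C)) (nu : R) T :
    let S := \sum_(p <- s) cabs p.2 in
    0 < nu0 -> nu0 + S <= nu -> S < nu0 -> coercive nu T ->
  cabs (\det (T + \sum_(p <- s) p.2 *: delta_mx p.1.1 p.1.2) - \det T) * (nu0 - S)
    <= S * cabs (\det T).
Proof.
elim: s nu T => [|[[j k] e] s IH] nu T /= nu00.
  by move=> _ _ _; rewrite !big_nil addr0 subrr cabs0 !mul0r.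
rewrite !big_cons /=; set S := \sum_(p <- s) _; set D := \sum_(p <- s) _.
move=> nuS Snu cT; rewrite addrA.
have S0 : 0 <= S by rewrite sumr_ge0 // => p _; exact: cabs_ge0.
have e0 := cabs_ge0 e.
have cT' := coerciveD j k e cT.
have /= := IH (nu - cabs e) (T + e *: delta_mx j k) nu00 _ _ cT'.
rewrite -/S -/D => /(_ ltac:(lra) ltac:(lra)).
have nugt0 : 0 < nu by lra.
rewrite det_delta ?(coercive_unitmx nugt0 cT) //.
have := coercive_invmx nugt0 cT k j.
move: (invmx _ _ _) (\det (_ + D)) (\det T) => t d' d tnu.
have x_le : cabs (e * t) * nu0 <= cabs e.
  rewrite cabsM -mulrA ler_piMr // (le_trans (ler_wpM2r (ltW nu00) tnu)) //.
  by rewrite mulrC ler_pdivrMr // mul1r; lra.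
have := cabs_ge0 (e * t).
have := cabs_ge0 d.
have -> : d' - d = (d' - d * (1 + e * t)) + d * (e * t) by ring.
have := cabsD (d' - d * (1 + e * t)) (d * (e * t)).
have := cabsD 1 (e * t); rewrite !(cabsM d) cabs1.
have := cabs_ge0 (d' - d * (1 + e * t)).
have := cabs_ge0 (d' - d * (1 + e * t) + d * (e * t)).
move: (cabs (_ + d * _)) (cabs (_ - _)) (cabs (1 + _)) (cabs d) x_le.
move: (cabs (e * t)) (cabs e) e0 nuS Snu.
move=> x r r0 nuS Snu u w y a xr u0 w0 yx uw a0 x0 H.
have h1 : w * (nu0 - S) <= S * (a * (1 + x)).
  by apply: le_trans H _; rewrite ler_wpM2l // ler_wpM2l.
have h2 : u * (nu0 - S) <= (w + a * x) * (nu0 - S) by rewrite ler_wpM2r //; lra.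
have h3 : a * (x * nu0) <= a * r by rewrite ler_wpM2l.
have h4 : 0 <= u * r by rewrite mulr_ge0.
lra.
Qed.

Lemma det_perturb nu T E : 0 < nu -> coercive nu T ->
    4 * (\sum_i \sum_j cabs (E i j)) <= nu ->
  cabs (\det (T + E) - \det T) <=
    4 / nu * (\sum_i \sum_j cabs (E i j)) * cabs (\det T).
Proof.
move=> nu0 cT; rewrite pair_bigA /=; set S := \sum_p _ => SE.
have S0 : 0 <= S by rewrite sumr_ge0 // => p _; exact: cabs_ge0.
pose s := [seq (p, E p.1 p.2) | p <- index_enum ('I_n * 'I_n)%type].
have sumS : \sum_(p <- s) cabs p.2 = S by rewrite big_map.
have sumE : \sum_(p <- s) p.2 *: delta_mx p.1.1 p.1.2 = E.
  by rewrite big_map [RHS]matrix_sum_delta pair_bigA.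
have /= := @det_perturb_seq (nu / 2) s nu T.
rewrite sumS sumE => /(_ ltac:(lra) ltac:(lra) ltac:(lra) cT).
move: (cabs_ge0 (\det (T + E) - \det T)).
move: (cabs (\det (T + E) - _)) (cabs (\det T)) => u a u0 H.
have -> : 4 / nu * S * a = 4 * S * a / nu by field; rewrite gt_eqF.
rewrite ler_pdivlMr //.
have : 0 <= u * (nu - 4 * S) by rewrite mulr_ge0 // subr_ge0.
lra.
Qed.

End Determinant.

Section UnitCircle.
Variable R : realType.
Implicit Types (a b t : R) (d : int) (n M : nat).

Local Lemma continuous_sin_within (a b : R) :
  {within `[a, b], continuous (@sin R)}%classic.
Proof. by apply: continuous_subspaceT => x; exact: continuous_sin. Qed.

Lemma sin_le t : 0 <= t -> sin t <= t.
Proof.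
rewrite le_eqVlt => /predU1P[<-|t0]; first by rewrite sin0.
have [c _] := MVT t0 (fun x _ => is_derive_sin x) (@continuous_sin_within 0 t).
by rewrite sin0 !subr0 => ->; rewrite ler_piMl ?cos_le1 // ltW.
Qed.

Lemma sqr_sin_le t : sin t ^+ 2 <= t ^+ 2.
Proof.
wlog t0 : t / 0 <= t => [H|].
  have [/H//|/ltW t0] := leP 0 t.
  by rewrite -sqrrN -sinN -[leRHS]sqrrN H // oppr_ge0.
rewrite -(ger0_norm t0) -real_normK ?num_real // lerXn2r ?nnegrE //.
rewrite (ger0_norm t0) ler_norml sin_le // andbT.
have [t1|/ltW t1] := leP t 1; last by rewrite (le_trans _ (sin_geN1 _)) // lerN2.
rewrite (le_trans _ (sin_ge0_pi _)) ?oppr_le0 // t0 (le_trans t1) //.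
by rewrite (le_trans _ (pi_ge2 _)) // ler1n.
Qed.

Lemma cexpiD a b : cexpi (a + b) = cexpi a * cexpi b.
Proof.
by rewrite /cexpi sinD cosD; simpc; congr (_ +i* _); rewrite addrC.
Qed.

Lemma cexpi0 : cexpi (0 : R) = 1.
Proof. by rewrite /cexpi cos0 sin0. Qed.

Lemma cexpi_2pi : cexpi (2 * pi : R) = 1.
Proof. by rewrite /cexpi mulr_natl cos2pi sin2pi. Qed.

Lemma cabs_cexpi t : cabs (cexpi t) = 1.
Proof. by rewrite /cabs /cexpi /= cos2Dsin2 sqrtr1. Qed.

Lemma cexpi_neq0 t : cexpi t != 0.
Proof. by rewrite -cabs_eq0 cabs_cexpi oner_neq0. Qed.

Lemma cexpiN t : cexpi (- t) = (cexpi t)^-1.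
Proof.
by apply: (mulIf (cexpi_neq0 t)); rewrite -cexpiD addNr cexpi0 mulVf ?cexpi_neq0.
Qed.

Lemma cexpi_conj t : (cexpi t)^* = (cexpi t)^-1.
Proof. by rewrite -cexpiN /cexpi cosN sinN. Qed.

Lemma cexpiX t n : cexpi t ^+ n = cexpi (n%:R * t).
Proof.
elim: n => [|n IH]; first by rewrite mul0r cexpi0.
by rewrite exprS IH -cexpiD; congr cexpi; rewrite -nat1r; ring.
Qed.

Lemma cexpiXz t d : cexpi t ^ d = cexpi (d%:~R * t).
Proof.
case: d => n; first by rewrite -exprnP cexpiX.
by rewrite NegzE -exprnN cexpiX -cexpiN mulrNz mulNr.
Qed.

Lemma sqr_cabs_cexpi_sub1 t : cabs (cexpi t - 1) ^+ 2 = 2 - 2 * cos t.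
Proof.
rewrite sqr_cabs /cexpi /= oppr0 addr0.
have -> : 2 - 2 * cos t = (cos t ^+ 2 + sin t ^+ 2) + 1 - 2 * cos t.
  by rewrite cos2Dsin2; ring.
by ring.
Qed.

Lemma cexpi_sub1_le t : cabs (cexpi t - 1) <= `|t|.
Proof.
rewrite -(@ler_pXn2r _ 2) ?nnegrE ?cabs_ge0 // sqr_cabs_cexpi_sub1.
rewrite real_normK ?num_real //.
have -> : cos t = 1 - 2 * sin (t / 2) ^+ 2.
  have {1}-> : t = (t / 2) *+ 2 by rewrite -mulr_natr; field.
  by rewrite cos_mulr2n cos2sin2 -mulr_natr; ring.
by have := sqr_sin_le (t / 2); rewrite expr_div_n; lra.
Qed.

Lemma cexpi_lipschitz a b : cabs (cexpi a - cexpi b) <= `|a - b|.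
Proof.
have -> : cexpi a - cexpi b = cexpi b * (cexpi (a - b) - 1).
  by rewrite mulrBr -cexpiD mulr1; congr (cexpi _ - _); ring.
by rewrite cabsM cabs_cexpi mul1r cexpi_sub1_le.
Qed.

Lemma cexpi_far t : pi / 2 <= `|t| -> `|t| <= 3 / 2 * pi -> 1 <= cabs (cexpi t - 1).
Proof.
move=> t1 t2; rewrite -(@ler_pXn2r _ 2) ?nnegrE ?cabs_ge0 //.
rewrite sqr_cabs_cexpi_sub1 expr1n -cos_norm.
suff : 0 <= cos (`|t| - pi).
  by rewrite cosB cospi sinpi; lra.
by apply: cos_ge0_pihalf; lra.
Qed.

Lemma cexpi_neq1 t : 0 < t < 2 * pi -> cexpi t != 1.
Proof.
move=> /andP[t0 t2].
have /sin_gt0_pi s0 : 0 < t / 2 < pi by rewrite divr_gt0 //= ltr_pdivrMr // mulrC.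
apply/eqP => /(congr1 (@complex.Re R)) /=.
have -> : t = (t / 2) *+ 2 by rewrite -mulr_natr; field.
rewrite cos_mulr2n cos2sin2.
by nra.
Qed.

Definition omega M : R[i] := cexpi (2 * pi / M%:R).

Lemma omegaX M p : omega M ^+ p = cexpi (2 * pi * (p%:R / M%:R)).
Proof. by rewrite cexpiX; congr cexpi; ring. Qed.

Lemma omegaXz M d : omega M ^ d = cexpi (2 * pi * (d%:~R / M%:R)).
Proof. by rewrite cexpiXz; congr cexpi; ring. Qed.

Lemma cabs_omegaX M p : cabs (omega M ^+ p) = 1.
Proof. by rewrite omegaX cabs_cexpi. Qed.

Lemma omega_neq0 M : omega M != 0.
Proof. exact: cexpi_neq0. Qed.

Lemma omegaXM M : (0 < M)%N -> omega M ^+ M = 1.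
Proof.
by move=> M0; rewrite omegaX divff ?mulr1 ?cexpi_2pi // pnatr_eq0 -lt0n.
Qed.

Lemma omega_mulr L m : (0 < L)%N -> omega (m * L) ^+ L = omega m.
Proof.
move=> L0; rewrite omegaX /omega natrM invfM [L%:R * _]mulrCA mulfV ?mulr1 //.
by rewrite pnatr_eq0 -lt0n.
Qed.

Lemma omega_prim M : (0 < M)%N -> M.-primitive_root (omega M).
Proof.
move=> M0; rewrite /primitive_root_of_unity M0; apply/forallP => -[i /= iM].
rewrite unity_rootE; have [->|iM'] := eqVneq i.+1 M; first by rewrite omegaXM ?eqxx.
rewrite omegaX (negbTE (cexpi_neq1 _)) // !mulr_gt0 ?pi_gt0 ?invr_gt0 ?ltr0n //=.
rewrite gtr_pMr ?mulr_gt0 ?pi_gt0 // ltr_pdivrMr ?ltr0n // mul1r ltr_nat.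
by rewrite ltn_neqAle iM' iM.
Qed.

Lemma omega_expz_eq1 M d : (0 < M)%N -> (omega M ^ d == 1) = (M %| `|d|)%N.
Proof.
move=> M0; have om n : (omega M ^+ n == 1) = (M %| n)%N.
  by rewrite -(prim_order_dvd (omega_prim M0)).
by case: d => n; rewrite ?NegzE -?exprnN -?exprnP ?invr_eq1 om.
Qed.

Lemma sum_omega M d : (0 < M)%N ->
  \sum_(p < M) (omega M ^+ p) ^ d = if (M %| `|d|)%N then M%:R else 0.
Proof.
move=> M0.
have -> : \sum_(p < M) (omega M ^+ p) ^ d = \sum_(p < M) (omega M ^ d) ^+ p.
  by apply: eq_bigr => p _; rewrite !exprnP !exprz_exp mulrC.
have := omega_expz_eq1 d M0; case: ifP => _.
  by move/eqP=> ->; under eq_bigr do rewrite expr1n; rewrite sumr_const card_ord.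
move=> w1; have : (omega M ^ d - 1) * \sum_(p < M) (omega M ^ d) ^+ p = 0.
  rewrite -subrX1 exprnP exprz_exp mulrC -exprz_exp -exprnP omegaXM //.
  by rewrite exp1rz subrr.
by move/eqP; rewrite mulf_eq0 subr_eq0 w1 => /eqP.
Qed.

End UnitCircle.

Section DiscreteFourier.
Variable R : realType.
Local Notation C := R[i].
Implicit Types (f g : C -> C) (d : int) (m n p L M : nat).

(* As in the Toeplitz matrices, the exponent is [+d]: this is the coefficient of index [-d]. *)
Definition dft M f d : C :=
  M%:R^-1 * \sum_(p < M) (omega R M ^+ p) ^ d * f (omega R M ^+ p).

Lemma omegaX_expzB M p (j k : nat) :
  (omega R M ^+ p) ^ (- j%:Z + k%:Z) =
  (omega R M ^+ p) ^- j * (omega R M ^+ p) ^+ k.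
Proof. by rewrite expfzDr ?expf_neq0 ?omega_neq0 // -exprnN -exprnP. Qed.

Definition dft_toeplitz M n f : 'M[C]_n :=
  \matrix_(j < n, k < n) dft M f (- j%:Z + k%:Z).

Lemma dft_toeplitz_form M n f (v : 'rV[C]_n) :
  \sum_k (v *m dft_toeplitz M n f) 0 k * (v 0 k)^* =
  M%:R^-1 * \sum_(p < M) f (omega R M ^+ p) *
     (cabs (\sum_j v 0 j * (omega R M ^+ p) ^- j) ^+ 2)%:C.
Proof.
under eq_bigr do rewrite mxE mulr_suml.
under eq_bigr do under eq_bigr do
  rewrite mxE /dft [_^-1 * _]mulrC mulrA mulrAC mulr_sumr mulr_suml.
under eq_bigr do rewrite -mulr_suml.
rewrite -mulr_suml mulrC; congr (_ * _).
under eq_bigr do rewrite exchange_big.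
rewrite exchange_big; apply: eq_bigr => p _.
rewrite cabs_sqr rmorph_sum /= mulr_suml mulr_sumr exchange_big.
apply: eq_bigr => j _; rewrite mulr_sumr mulr_sumr; apply: eq_bigr => k _.
have -> : ((v 0 k * (omega R M ^+ p) ^- k)^* = (v 0 k)^* * (omega R M ^+ p) ^+ k)%R.
  by rewrite rmorphM /= -exprVn rmorphXn /= omegaX -cexpi_conj [X in X ^+ _]conjcK.
by rewrite omegaX_expzB; ring.
Qed.

Lemma dft1 M d : (0 < M)%N -> dft M (fun=> 1) d = (M %| `|d|)%N%:R.
Proof.
move=> M0; rewrite /dft; under eq_bigr do rewrite mulr1.
by rewrite sum_omega //; case: ifP => _; rewrite ?mulr0 // mulVf // pnatr_eq0 -lt0n.
Qed.

Lemma dft_toeplitz1 M n : (n <= M)%N -> (0 < M)%N ->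
  dft_toeplitz M n (fun=> 1) = 1%:M.
Proof.
move=> nM M0; apply/matrixP => j k; rewrite !mxE dft1 //; congr (_%:R).
have [<-|jk] := eqVneq j k; first by rewrite addNr dvdn0.
congr nat_of_bool; apply/negbTE/negP => /dvdn_leq.
have : (j != k :> nat) by rewrite val_eqE.
by move: (ltn_ord j) (ltn_ord k); lia.
Qed.

Lemma dft_toeplitz_coercive M n f (mu : R) : (n <= M)%N -> (0 < M)%N ->
  (forall p, (p < M)%N -> mu%:C <= f (omega R M ^+ p)) ->
  coercive mu (dft_toeplitz M n f).
Proof.
move=> nM M0 muf v; pose V p := cabs (\sum_j v 0 j * (omega R M ^+ p) ^- j).
have fV p : (p < M)%N -> f (omega R M ^+ p) = (complex.Re (f (omega R M ^+ p)))%:C.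
  by move=> /muf; case: (f _) => a b; rewrite lecE /= => /andP[/eqP -> _].
have -> : \sum_i cabs (v 0 i) ^+ 2 = M%:R^-1 * \sum_(p < M) V p ^+ 2.
  apply: complexI; rewrite rmorphM /= rmorph_sum /= fmorphV /= rmorph_nat.
  rewrite rmorph_sum /=.
  have := dft_toeplitz_form M (fun=> 1) v; rewrite dft_toeplitz1 // mulmx1.
  under [X in _ = _ * X -> _]eq_bigr do rewrite mul1r.
  by move=> <-; apply: eq_bigr => i _; rewrite cabs_sqr.
rewrite dft_toeplitz_form cabsM cabsV cabs_nat mulrCA ler_pM2l ?invr_gt0 ?ltr0n //.
rewrite mulr_sumr.
have -> : \sum_(p < M) f (omega R M ^+ p) * (V p ^+ 2)%:C =
    (\sum_(p < M) complex.Re (f (omega R M ^+ p)) * V p ^+ 2)%:C.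
  by rewrite rmorph_sum /=; apply: eq_bigr => p _; rewrite {1}fV ?ltn_ord // [RHS]rmorphM.
rewrite cabs_real (le_trans _ (ler_norm _)) //; apply: ler_sum => p _.
by rewrite ler_wpM2r ?sqr_ge0 // -lecR -fV ?muf ?ltn_ord.
Qed.

Lemma dftDM M f d : (0 < M)%N -> dft M f (d - M%:Z) = dft M f d.
Proof.
move=> M0; congr (_ * _); apply: eq_bigr => p _; congr (_ * _).
rewrite expfzDr ?expf_neq0 ?omega_neq0 // -exprnN.
by rewrite exprAC omegaXM // expr1n invr1 mulr1.
Qed.

Lemma dft_alias m L f d : (0 < m)%N -> (0 < L)%N ->
  dft m f d = \sum_(p < L) dft (m * L) f (d + (m * p)%N%:Z).
Proof.
move=> m0 L0; set W := omega R (m * L).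
have W0 s : W ^+ s != 0 by rewrite expf_neq0 ?omega_neq0.
have Lm : W ^+ m = omega R L by rewrite /W mulnC omega_mulr.
rewrite /dft -mulr_sumr exchange_big /= -/W.
have E s : \sum_(p < L) (W ^+ s) ^ (d + (m * p)%N%:Z) * f (W ^+ s) =
    (W ^+ s) ^ d * f (W ^+ s) * (if (L %| s)%N then L%:R else 0).
  have /= <- := sum_omega R s%:Z L0; rewrite mulr_sumr; apply: eq_bigr => p _.
  by rewrite expfzDr // -!exprnP -Lm -!exprM mulrAC; congr (_ * W ^+ _); rewrite mulnC.
rewrite [X in _ = _ * X](_ : _ = \sum_(0 <= s < m * L) (W ^+ s) ^ d * f (W ^+ s) *
    (if (L %| s)%N then L%:R else 0)); last first.
  by rewrite big_mkord; apply: eq_bigr => s _; exact: E.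
rewrite big_nat_mul big_mkord.
under [in RHS]eq_bigr => a _.
  rewrite -{1}[(a * L)%N]add0n big_addn mulSn addnK big_mkord.
  rewrite (bigD1 (Ordinal L0)) //= add0n dvdn_mull // big1 ?addr0 => [|i i0]; last first.
    have i0' : (0 < i)%N by rewrite lt0n; apply: contra i0 => /eqP i0; apply/eqP/val_inj.
    by rewrite dvdn_addl ?dvdn_mull // gtnNdvd // mulr0.
  rewrite mulnC exprM omega_mulr //.
  over.
rewrite -mulr_suml natrM invfM mulrAC -mulrA; congr (_ * _).
by rewrite mulfK // pnatr_eq0 -lt0n.
Qed.

Lemma sum_geometric_le (rho : R) n : 0 <= rho < 1 ->
  \sum_(i < n) rho ^+ i <= (1 - rho)^-1.
Proof.
move=> /andP[r0 r1]; rewrite -[leRHS]mul1r ler_pdivlMr ?subr_gt0 //.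
have : 0 <= rho ^+ n by rewrite exprn_ge0.
have := subrX1 rho n; lra.
Qed.

Lemma sum_rev_ord (rho : R) n : \sum_(i < n) rho ^+ rev_ord i = \sum_(i < n) rho ^+ i.
Proof. by rewrite [RHS](reindex_inj rev_ord_inj). Qed.

Lemma dft_refine (rho B : R) m L f d : 0 <= rho < 1 -> 0 <= B ->
    (forall M d, (0 < M)%N -> (2 * `|d| <= M)%N -> cabs (dft M f d) <= B * rho ^+ `|d|) ->
    (`|d| < m)%N -> (0 < L)%N ->
  cabs (dft m f d - dft (m * L) f d) <= 2 * B / (1 - rho) * rho ^+ (m - `|d|).
Proof.
move=> /[dup] rho01 /andP[r0 r1] B0 decay dm; case: L => // L _.
have m0 : (0 < m)%N by lia.
have mL0 : (0 < m * L.+1)%N by rewrite muln_gt0 m0.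
rewrite (@dft_alias _ L.+1) // big_ord_recl muln0 addr0 addrAC subrr add0r.
apply: le_trans (cabs_sum _ _ _) _.
have term (p : 'I_L) : cabs (dft (m * L.+1) f (d + (m * lift ord0 p)%N%:Z)) <=
    B * rho ^+ (m - `|d|) * (rho ^+ p + rho ^+ (rev_ord p)).
  have pL := ltn_ord p; rewrite lift0 /=.
  have mono (a b : nat) : (a <= b)%N -> B * rho ^+ b <= B * rho ^+ a.
    by move=> ab; rewrite ler_wpM2l // ler_wiXn2l // ltW.
  rewrite mulrDr -!mulrA -!exprD.
  have [h|h] := leqP (2 * `|(d + (m * p.+1)%N%:Z)%R|)%N (m * L.+1)%N.
    apply: le_trans (decay _ _ mL0 h) _.
    apply: (@le_trans _ _ (B * rho ^+ (m - `|d| + p))); last first.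
      by rewrite lerDl mulr_ge0 // exprn_ge0.
    apply: mono; rewrite mulnS; have : (p <= m * p)%N by rewrite leq_pmull.
    by lia.
  have mp : (m * p.+1 <= m * L)%N by rewrite leq_mul2l pL orbT.
  have mLp : (m * L = m * p.+1 + m * (L - p.+1))%N by rewrite -mulnDr subnKC.
  have mLp' : (L - p.+1 <= m * (L - p.+1))%N by rewrite leq_pmull.
  rewrite -dftDM //; have hM := mulnS m L.
  apply: le_trans (decay _ _ mL0 _) _; first by lia.
  apply: (@le_trans _ _ (B * rho ^+ (m - `|d| + (L - p.+1)))); last first.
    by rewrite lerDr mulr_ge0 // exprn_ge0.
  by apply: mono; lia.
apply: (@le_trans _ _ (\sum_(p < L) B * rho ^+ (m - `|d|) * (rho ^+ p + rho ^+ (rev_ord p)))).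
  by apply: ler_sum => p _; exact: term.
rewrite -mulr_sumr big_split sum_rev_ord /=.
have := sum_geometric_le L rho01; move: (\sum_(_ < _) _) => S SL.
have x0 := exprn_ge0 (m - `|d|) r0; move: (_^-1) (rho ^+ _) SL x0 => b x Sb x0.
have : 0 <= B * x * (b - S) by rewrite !mulr_ge0 // subr_ge0.
lra.
Qed.

Lemma sum_toeplitz_geometric_le (rho : R) m n : 0 <= rho < 1 -> (n <= m)%N ->
  \sum_(j < n) \sum_(k < n) rho ^+ (m - `|(- j%:Z + k%:Z)%R|) <=
  2 * (1 - rho) ^- 2 * rho ^+ (m - n).
Proof.
move=> /[dup] rho01 /andP[r0 r1] nm.
have term (j k : 'I_n) : rho ^+ (m - `|(- j%:Z + k%:Z)%R|) <=
    rho ^+ (m - n) * (rho ^+ rev_ord j * rho ^+ k + rho ^+ j * rho ^+ rev_ord k).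
  have jn := ltn_ord j; have kn := ltn_ord k; rewrite mulrDr -!exprD /=.
  have mono (a b : nat) : (a <= b)%N -> rho ^+ b <= rho ^+ a.
    by move=> ab; rewrite ler_wiXn2l // ltW.
  have [jk|jk] := leqP k j.
    apply: (@le_trans _ _ (rho ^+ (m - n + (n - j.+1 + k)))); first by apply: mono; lia.
    by rewrite lerDl exprn_ge0.
  apply: (@le_trans _ _ (rho ^+ (m - n + (j + (n - k.+1))))); first by apply: mono; lia.
  by rewrite lerDr exprn_ge0.
apply: (@le_trans _ _ (\sum_(j < n) \sum_(k < n)
    rho ^+ (m - n) * (rho ^+ rev_ord j * rho ^+ k + rho ^+ j * rho ^+ rev_ord k))).
  by apply: ler_sum => j _; apply: ler_sum => k _; exact: term.
under eq_bigr do rewrite -mulr_sumr big_split -!mulr_sumr.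
rewrite -mulr_sumr mulrC big_split -!mulr_suml.
rewrite !sum_rev_ord /=.
have S0 : 0 <= \sum_(i < n) rho ^+ i by apply: sumr_ge0 => i _; rewrite exprn_ge0.
have := sum_geometric_le n rho01; move: (\sum_(_ < _) _) S0 => S S0 SL.
rewrite ler_wpM2r ?exprn_ge0 // -exprVn.
move: (_^-1) SL => b Sb; nra.
Qed.

End DiscreteFourier.

Section Decay.
Variable R : realType.
Local Notation C := R[i].
Implicit Types (f g : C -> C) (w z : C) (d : int) (k n p q M : nat).

Fixpoint qdiff w k g : C -> C :=
  if k is k'.+1 then fun z => qdiff w k' g (w * z) - w ^+ k' * qdiff w k' g z else g.

Lemma qdiffB w k f g z :
  qdiff w k (fun z => f z - g z) z = qdiff w k f z - qdiff w k g z.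
Proof. by elim: k z => [//|k IH] z /=; rewrite !IH; ring. Qed.

Lemma qdiff_sumX w k n (c : nat -> C) z :
  qdiff w k (fun z => \sum_(l < n) c l * z ^+ l) z =
  \sum_(l < n) c l * (\prod_(i < k) (w ^+ l - w ^+ i)) * z ^+ l.
Proof.
elim: k z => [|k IH] z /=; first by apply: eq_bigr => l _; rewrite big_ord0 mulr1.
rewrite !IH mulr_sumr -sumrB; apply: eq_bigr => l _.
by rewrite big_ord_recr /= exprMn; ring.
Qed.

Lemma qdiff_poly w k (P : {poly C}) z : (size P <= k)%N ->
  qdiff w k (horner P) z = 0.
Proof.
move=> Pk; have -> : horner P = fun z => \sum_(l < k) P`_l * z ^+ l.
  by apply/funext => x; rewrite (horner_coef_wide _ Pk).
rewrite qdiff_sumX big1 // => l _; rewrite (bigD1 l) //= subrr.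
by rewrite mul0r mulr0 mul0r.
Qed.

Lemma qdiff_le w k g z (b : R) : cabs w = 1 ->
  (forall i, (i <= k)%N -> cabs (g (w ^+ i * z)) <= b) ->
  cabs (qdiff w k g z) <= 2 ^+ k * b.
Proof.
move=> w1; elim: k z => [|k IH] z gb /=.
  by have := gb 0%N isT; rewrite !mul1r.
rewrite (le_trans (cabsD _ _)) // cabsN cabsM cabsX w1 expr1n mul1r exprS.
have h1 := IH z (fun i ik => gb i (leqW ik)).
have h2 : cabs (qdiff w k g (w * z)) <= 2 ^+ k * b.
  by apply: IH => i ik; have := gb i.+1; rewrite exprSr -mulrA; apply.
lra.
Qed.

Lemma sum_omega_rot M g : (0 < M)%N ->
  \sum_(p < M) g (omega R M * omega R M ^+ p) = \sum_(p < M) g (omega R M ^+ p).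
Proof.
case: M => // M _; rewrite big_ord_recr big_ord_recl /= -exprS omegaXM // addrC.
by congr (_ + _); apply: eq_bigr => p _; rewrite -exprS.
Qed.

Lemma dft_rot M g d : (0 < M)%N ->
  dft M (fun z => g (omega R M * z)) d = omega R M ^ (- d) * dft M g d.
Proof.
move=> M0; rewrite /dft mulrCA; congr (_ * _).
rewrite -(sum_omega_rot (fun z => z ^ d * g z)) // mulr_sumr.
apply: eq_bigr => p _; rewrite mulrA; congr (_ * _).
rewrite expfzMl mulrA -expfzDr ?omega_neq0 // addNr expr0z mul1r //.
Qed.

Lemma dft_rotX M g d q : (0 < M)%N ->
  dft M (fun z => g (omega R M ^+ q * z)) d = (omega R M ^+ q) ^ (- d) * dft M g d.
Proof.
move=> M0; elim: q => [|q IH].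
  by rewrite exp1rz mul1r; congr dft; apply/funext => z; rewrite mul1r.
rewrite exprS expfzMl -mulrA -IH -dft_rot //.
by congr dft; apply/funext => z; rewrite mulrCA mulrA.
Qed.

Lemma dft_qdiff M f d q k : (0 < M)%N -> let w := omega R M ^+ q in
  dft M (qdiff w k f) d = (\prod_(i < k) (w ^ (- d) - w ^+ i)) * dft M f d.
Proof.
move=> M0 w; elim: k => [|k IH] /=; first by rewrite big_ord0 mul1r.
have -> : dft M (fun z => qdiff w k f (w * z) - w ^+ k * qdiff w k f z) d =
    dft M (fun z => qdiff w k f (w * z)) d - w ^+ k * dft M (qdiff w k f) d.
  rewrite /dft mulrCA -mulrBr; congr (_ * _).
  by rewrite mulr_sumr -sumrB; apply: eq_bigr => p _; ring.
by rewrite dft_rotX // IH big_ord_recr /= -/w; ring.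
Qed.

Lemma dft_le M f d (b : R) : (0 < M)%N ->
  (forall p, (p < M)%N -> cabs (f (omega R M ^+ p)) <= b) -> cabs (dft M f d) <= b.
Proof.
move=> M0 fb; rewrite cabsM cabsV cabs_nat mulrC ler_pdivrMr ?ltr0n //.
apply: le_trans (cabs_sum _ _ _) _.
apply: (@le_trans _ _ (\sum_(p < M) b)); last first.
  by rewrite sumr_const card_ord mulr_natr.
apply: ler_sum => p _; rewrite cabsM omegaX cexpiXz cabs_cexpi mul1r -omegaX.
exact: fb.
Qed.

Definition local_approx f (delta B : R) := forall t, 0 <= t <= 2 * pi -> forall k,
  exists P : {poly C}, (size P <= k)%N /\
    forall z, cabs (z - cexpi t) <= delta -> cabs (f z - P.[z]) <= B * 8 ^- k.

(* The step: an angle q/M of a full turn which the frequency d magnifies to between one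
   third and two thirds of a turn. *)
Lemma rotation_step M d : d != 0 -> (2 * `|d| <= M)%N ->
  exists q, (M <= 3 * q * `|d| <= 2 * M)%N.
Proof.
move=> d0 dM; have d1 : (0 < `|d|)%N by rewrite absz_gt0.
have ex : exists q, (M <= 3 * q * `|d|)%N by exists M; nia.
exists (ex_minn ex); case: ex_minnP => q q1 minq; rewrite q1 /=.
case: q q1 minq => [|[|q]] q1 minq; [by lia|by lia|].
have [/minq|] := leqP M (3 * q.+1 * `|d|); first by rewrite ltnn.
by nia.
Qed.

Lemma dft_decay_pow f (delta B : R) K M d : local_approx f delta B ->
    (8 <= K)%N -> 6 <= K%:R * delta -> (0 < M)%N -> (2 * `|d| <= M)%N ->
  cabs (dft M f d) <= B * 4 ^- (`|d| %/ K).
Proof.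
move=> fP K8 Kd M0 dM; set k := (`|d| %/ K)%N.
have Mr0 : 0 < M%:R :> R by rewrite ltr0n.
have kK : (k * K <= `|d|)%N by exact: leq_divM.
have [q [far near]] : exists q,
    (forall i, (i < k)%N -> M <= 4 * q * `|(d + i%:Z)%R| <= 3 * M)%N /\
    (3 * q * k * K <= 2 * M)%N.
  have [d0|d0] := eqVneq d 0.
    by exists 0%N; split => [i|]; rewrite /k d0 ?div0n //; lia.
  have [q /andP[q1 q2]] := rotation_step d0 dM; exists q.
  have kd : (8 * k <= `|d|)%N by nia.
  split=> [i ik|]; last by nia.
  have h1 : (7 * `|d| <= 8 * `|(d + i%:Z)%R|)%N by lia.
  have h2 : (8 * `|(d + i%:Z)%R| <= 9 * `|d|)%N by lia.
  by apply/andP; split; nia.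
set w := omega R M ^+ q.
have w1 : cabs w = 1 by rewrite cabs_omegaX.
have w0 : w != 0 by rewrite expf_neq0 ?omega_neq0.
have pi4 : pi < 4 :> R by have := pihalf_lt2 R; lra.
have pi0 := pi_gt0 R.
have wE (j : int) : w ^ j = cexpi (2 * pi * ((q%:R * j%:~R) / M%:R)).
  by rewrite /w exprnP exprz_exp omegaXz; congr cexpi; rewrite intrM.
have prod_ge : 1 <= cabs (\prod_(i < k) (w ^ (- d) - w ^+ i)).
  rewrite cabs_prod; elim/big_ind : _ => [//|x y x1 y1|i _]; first exact: mulr_ege1.
  have -> : w ^ (- d) - w ^+ i = - (w ^ (- d) * (w ^ (d + i%:Z) - 1)).
    by rewrite mulrBr -expfzDr // addKr mulr1 opprB -exprnP.
  rewrite cabsN cabsM wE cabs_cexpi mul1r wE.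
  have /andP := far i (ltn_ord i); rewrite -!(ler_nat R) !natrM => -[h1 h2].
  have e : `|(d + i%:Z)%:~R| = (`|(d + i%:Z)%R|%N)%:R :> R.
    by rewrite -intr_norm -abszE.
  apply: cexpi_far; rewrite !normrM normfV !normr_nat e (gtr0_norm pi0).
    rewrite mulrA ler_pdivlMr //; nra.
  rewrite mulrA ler_pdivrMr //; nra.
have : cabs (dft M (qdiff w k f) d) <= B * 4 ^- k.
  apply: dft_le => // p pM.
  have tp : 0 <= 2 * (pi : R) * (p%:R / M%:R) <= 2 * (pi : R).
    have h0 : (0 : R) <= p%:R / M%:R by rewrite divr_ge0.
    have h1 : p%:R / M%:R <= 1 :> R by rewrite ler_pdivrMr // mul1r ler_nat ltnW.
    by apply/andP; split; nra.
  have [P [Pk fPz]] := fP _ tp k; rewrite -omegaX in fPz.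
  have -> : qdiff w k f (omega R M ^+ p) =
      qdiff w k (fun z => f z - P.[z]) (omega R M ^+ p).
    by rewrite qdiffB qdiff_poly // subr0.
  have -> : B * 4 ^- k = 2 ^+ k * (B * 8 ^- k).
    have -> : (8 : R) = 2 * 4 by ring.
    by rewrite exprMn; field; rewrite !expf_neq0.
  apply: qdiff_le => // i ik; apply: fPz.
  have -> : w ^+ i * omega R M ^+ p - omega R M ^+ p = omega R M ^+ p * (w ^+ i - 1).
    by ring.
  rewrite cabsM cabs_omegaX mul1r exprnP wE (le_trans (cexpi_sub1_le _)) //.
  rewrite !normrM normfV !normr_nat (gtr0_norm pi0).
  have h : (3 * q * i * K <= 2 * M)%N.
    by rewrite (leq_trans _ near) // leq_mul2r leq_mul2l ik !orbT.
  rewrite mulrA ler_pdivrMr //.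
  have K0 : 0 < K%:R :> R by rewrite ltr0n (leq_trans _ K8).
  move: h; rewrite -(ler_nat R) !natrM => h.
  rewrite -(ler_pM2r K0).
  have : 6 * M%:R <= K%:R * delta * M%:R by rewrite ler_wpM2r // ltW.
  nra.
rewrite dft_qdiff // cabsM; apply: le_trans; rewrite ler_peMl ?cabs_ge0 //.
Qed.

Lemma dft_decay f (delta B : R) K M d : local_approx f delta B -> 0 <= B ->
    (8 <= K)%N -> 6 <= K%:R * delta -> (0 < M)%N -> (2 * `|d| <= M)%N ->
  cabs (dft M f d) <= 4 * B * expR (- K%:R^-1) ^+ `|d|.
Proof.
move=> fP B0 K8 Kd M0 dM; apply: le_trans (dft_decay_pow fP K8 Kd M0 dM) _.
set k := (`|d| %/ K)%N; rewrite (mulrC 4) -mulrA ler_wpM2l //.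
have kK : (`|d| < k.+1 * K)%N by rewrite ltn_ceil //; lia.
have K0 : K%:R != 0 :> R by rewrite pnatr_eq0; lia.
rewrite -expRM_natl.
have : expR (- 1) ^+ k.+1 <= expR (`|d|%:R * - K%:R^-1) :> R.
  rewrite -expRM_natl ler_expR !mulrN mulr1 lerN2 ler_pdivrMr ?ltr0n; last by lia.
  by rewrite -natrM ler_nat ltnW.
have : 4^-1 ^+ k.+1 <= expR (- 1) ^+ k.+1 :> R.
  rewrite lerXn2r ?nnegrE ?expR_ge0 ?invr_ge0 //.
  have -> : - 1 = (- 2^-1) + (- 2^-1) :> R by field.
  by rewrite expRD; have := expR_ge1Dx (- 2^-1 : R); nra.
rewrite exprS exprVn; lra.
Qed.

End Decay.

Section Taylor.
Variable R : realType.
Local Notation C := R[i].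
Implicit Types (f : C -> C) (a z : C) (k : nat).
Local Open Scope classical_set_scope.

Lemma cvg_seq_eps (K : numFieldType) (s : nat -> K) (l : K) : s @ \oo --> l ->
  forall e : K, 0 < e -> exists N, forall n, (N <= n)%N -> `|l - s n| < e.
Proof. by move=> /cvgrPdist_lt sl e /sl[N _ HN]; exists N => n; exact: HN. Qed.

Lemma cvg_cabs (s : nat -> C) (l : C) :
  s @ \oo --> (l : (C : numFieldType)) ->
  forall e : R, 0 < e -> exists N, forall n, (N <= n)%N -> cabs (l - s n) < e.
Proof.
move=> sl e e0; have e0' : 0 < e%:C by rewrite ltcR.
have [N HN] := @cvg_seq_eps C s l sl _ e0'.
by exists N => n Nn; rewrite -ltcR -normcabs; apply: HN.
Qed.

Lemma analytic_at_taylor f a : analytic_at f a ->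
  exists (u : nat -> C) (B x : R), [/\ 0 <= B, 0 < x & forall k z,
    cabs (z - a) <= x / 2 ->
    cabs (f z - \sum_(l < k) u l * (z - a) ^+ l) <= B * (cabs (z - a) / x) ^+ k].
Proof.
move=> [u [r [r0 fu]]].
have [r' rE] : exists r' : R, r = r'%:C.
  by apply/complex_realP; rewrite gtr0_real.
move: r0 fu; rewrite {r}rE ltcR => r0 fu.
set x := r' / 2; have x0 : 0 < x by rewrite divr_gt0.
have [B0 [B00 uB0]] : exists B0 : R, 0 <= B0 /\ forall l, cabs (u l) * x ^+ l <= B0.
  have /fu/cvg_cabs/(_ 1 ltr01)[N sN] : `|(a + x%:C) - a| < r'%:C.
    by rewrite addrC addKr normcabs cabs_real gtr0_norm // ltcR /x; lra.
  exists (2 + \sum_(l < N) cabs (u l) * x ^+ l).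
  have pos (l : nat) : 0 <= cabs (u l) * x ^+ l.
    by rewrite mulr_ge0 ?cabs_ge0 // exprn_ge0 // ltW.
  split=> [|l]; first by rewrite addr_ge0 // sumr_ge0.
  have [lN|Nl] := ltnP l N.
    rewrite (bigD1 (Ordinal lN)) //= addrCA lerDl addr_ge0 //.
    by rewrite sumr_ge0.
  have -> : cabs (u l) * x ^+ l = cabs (u l * (a + x%:C - a) ^+ l).
    by rewrite addrC addKr cabsM cabsX cabs_real gtr0_norm.
  have := sN _ Nl; have := sN _ (leqW Nl).
  rewrite /series /= big_nat_recr //=.
  set S := \sum_(0 <= k < l) _; set ul := u l * _; set L := f _ => h1 h2.
  have -> : ul = (L - S) - (L - (S + ul)) by ring.
  have := cabsD (L - S) (- (L - (S + ul))); rewrite cabsN.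
  have : 0 <= \sum_(l < N) cabs (u l) * x ^+ l by rewrite sumr_ge0.
  lra.
exists u, (2 * B0), x; split => // [|k z zx]; first by rewrite mulr_ge0.
set t := cabs (z - a) / x.
have t0 : 0 <= t by rewrite divr_ge0 ?cabs_ge0 // ltW.
have t12 : t <= 1 / 2 by rewrite ler_pdivrMr // mulrC mulrA mulr1.
have zr : `|z - a| < r'%:C by rewrite normcabs ltcR; move: zx; rewrite /x; lra.
apply/ler_addgt0Pr => e e0.
have [N sN] := cvg_cabs (fu _ zr) e0.
have := sN (N + k)%N (leq_addr _ _); rewrite /series /=.
rewrite (@big_cat_nat _ _ _ k) ?leq_addl //= big_mkord.
set S := \sum_(l < k) _; set T := \sum_(k <= l < _) _ => h.
have -> : f z - S = (f z - (S + T)) + T by ring.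
suff : cabs T <= 2 * B0 * t ^+ k by have := cabsD (f z - (S + T)) T; lra.
rewrite /T -{1}[k]add0n big_addn addnK big_mkord.
apply: le_trans (cabs_sum _ _ _) _.
apply: (@le_trans _ _ (\sum_(l < N) B0 * t ^+ k * t ^+ l)).
  apply: ler_sum => l _; rewrite cabsM cabsX -mulrA -exprD addnC /t expr_div_n.
  rewrite mulrA ler_pdivlMr ?exprn_gt0 // mulrAC ler_wpM2r ?exprn_ge0 ?cabs_ge0 //.
have -> : 2 * B0 * t ^+ k = B0 * t ^+ k * 2 by ring.
rewrite -mulr_sumr ler_wpM2l ?mulr_ge0 ?exprn_ge0 //.
have /sum_geometric_le/le_trans : 0 <= t < 1 by lra.
apply; rewrite -[leRHS]invrK lef_pV2 ?posrE ?invr_gt0 //; lra.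
Qed.

Lemma compact_uniform (a b : R) (Q : nat -> R -> Prop) :
    (forall t, a <= t <= b -> exists (d : R) (N0 : nat), 0 < d /\
       forall N s, (N0 <= N)%N -> `|s - t| < d -> Q N s) ->
  exists N, forall t, a <= t <= b -> Q N t.
Proof.
move=> H; have /compact_near_coveringP := @segment_compact R a b.
move=> /(_ nat \oo Q _)[t /=|N _ HN].
  rewrite in_itv /= => /H[d [N0 [d0 HQ]]].
  exists (ball t d, [set n | (N0 <= n)%N]).
    by split; [exact: nbhsx_ballx|exists N0].
  by move=> [s n] /= [ts N0n]; apply: HQ => //; rewrite distrC.
by exists N => t tab; apply: (HN N) => //=; rewrite in_itv.
Qed.

Lemma inv_natS_lt (x : R) : 0 < x -> exists N0, forall N, (N0 <= N)%N -> N.+1%:R^-1 < x.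
Proof.
move=> x0; exists (Num.truncn x^-1) => N NN; rewrite -[ltRHS]invrK.
rewrite ltf_pV2 ?posrE ?invr_gt0 ?ltr0n //.
by rewrite (lt_le_trans (truncnS_gt _)) // ler_nat.
Qed.

End Taylor.

Section CircleSymbol.
Variable R : realType.
Local Notation C := R[i].
Implicit Types (f : C -> C) (t : R).

Lemma continuous_ptP (h : R -> R) t : {for t, continuous h} <->
  forall e, 0 < e -> exists d, 0 < d /\ forall s, `|s - t| < d -> `|h s - h t| <= e.
Proof.
split=> [hc e e0|H].
  have /cvgrPdist_le/(_ e e0)/nbhs_ballP[d d0 Hd] := hc.
  by exists d; split => // s st; rewrite distrC; apply: Hd; rewrite /ball /= distrC.
apply/cvgrPdist_le => e /H[d [d0 Hd]]; apply/nbhs_ballP; exists d => // s /= st.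
by rewrite distrC; apply: Hd; rewrite distrC.
Qed.

Lemma taylor_poly (u : nat -> C) (a : C) k : exists P : {poly C},
  (size P <= k)%N /\ forall z, P.[z] = \sum_(l < k) u l * (z - a) ^+ l.
Proof.
exists (\sum_(l < k) u l *: ('X - a%:P) ^+ l); split.
  apply: leq_trans (size_sum _ _ _) _; apply/bigmax_leqP => l _.
  by rewrite (leq_trans (size_scale_leq _ _)) // size_exp_XsubC.
move=> z; rewrite horner_sum; apply: eq_bigr => l _.
by rewrite hornerZ horner_exp hornerXsubC.
Qed.

Lemma analytic_local_approx f : (forall t, analytic_at f (cexpi t)) ->
  exists delta B, [/\ 0 < delta, 0 <= B & local_approx f delta B].
Proof.
move=> fa.
pose Q (N : nat) t := forall k, exists P : {poly C}, (size P <= k)%N /\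
  forall z, cabs (z - cexpi t) <= N.+1%:R^-1 -> cabs (f z - P.[z]) <= N%:R * 8 ^- k.
have [|N HN] := @compact_uniform R 0 (2 * pi) Q.
  move=> t _; have [u [B [x [B0 x0 H]]]] := analytic_at_taylor (fa t).
  have x16 : 0 < x / 16 by rewrite divr_gt0.
  have [N0 N0x] := inv_natS_lt x16.
  exists (x / 16), (maxn N0 (Num.truncn B).+1); split => // N s.
  rewrite geq_max => /andP[NN0 NB] st k.
  have [P [Pk PE]] := taylor_poly u (cexpi t) k; exists P; split => // z zs.
  have zt : cabs (z - cexpi t) <= x / 8.
    have -> : z - cexpi t = (z - cexpi s) + (cexpi s - cexpi t) by ring.
    have := cexpi_lipschitz s t; have := le_lt_trans zs (N0x N NN0).
    have := cabsD (z - cexpi s) (cexpi s - cexpi t); lra.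
  rewrite PE (le_trans (H _ _ _)) //; first by lra.
  apply: (@le_trans _ _ (N%:R * (cabs (z - cexpi t) / x) ^+ k)).
    rewrite ler_wpM2r ?exprn_ge0 ?divr_ge0 ?cabs_ge0 ?(ltW x0) //.
    by rewrite (le_trans (ltW (truncnS_gt B))) // ler_nat.
  rewrite ler_wpM2l // -exprVn lerXn2r ?nnegrE ?divr_ge0 ?cabs_ge0 ?(ltW x0) //.
  by rewrite ler_pdivrMr // mulrC.
by exists N.+1%:R^-1, N%:R; rewrite invr_gt0 ltr0n ler0n; split.
Qed.

Lemma circle_symbol_continuous f : (forall t, analytic_at f (cexpi t)) ->
  continuous (fun t => complex.Re (f (cexpi t))).
Proof.
move=> fa t; have [u [B [x [B0 x0 H]]]] := analytic_at_taylor (fa t).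
have {}H z : cabs (z - cexpi t) <= x / 2 ->
    cabs (f z - u 0%N) <= B * (cabs (z - cexpi t) / x).
  by move/(H 1%N); rewrite big_ord1 expr0 mulr1 expr1.
have fE : f (cexpi t) = u 0%N.
  have := H (cexpi t); rewrite subrr cabs0 mul0r mulr0 => /(_ ltac:(lra)) h.
  by apply/eqP; rewrite -subr_eq0 -cabs_eq0 eq_le h cabs_ge0.
apply/continuous_ptP => e e0.
have B1 : 0 < B + 1 by lra.
exists (Num.min (x / 2) (e * x / (B + 1))); split.
  by rewrite lt_min !divr_gt0 ?mulr_gt0.
move=> s; rewrite lt_min => /andP[st1 st2].
have cst := cexpi_lipschitz s t.
have -> : complex.Re (f (cexpi s)) - complex.Re (f (cexpi t)) =
    complex.Re (f (cexpi s) - f (cexpi t)) by case: (f _) (f _) => [? ?] [? ?].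
apply: le_trans (cabs_Re _) _.
have := H (cexpi s) (ltW (le_lt_trans cst st1)); rewrite -fE => h.
apply: le_trans h _; rewrite mulrA ler_pdivrMr //.
move: (le_lt_trans cst st2); rewrite ltr_pdivlMr // mulrDr mulr1 mulrC => /ltW.
by apply: le_trans; rewrite lerDl cabs_ge0.
Qed.

Lemma circle_symbol_real f t : (forall z : C, `|z| = 1 -> 0 < f z) ->
  f (cexpi t) = (complex.Re (f (cexpi t)))%:C /\ 0 < complex.Re (f (cexpi t)).
Proof.
move=> /(_ (cexpi t)); rewrite normcabs cabs_cexpi => /(_ erefl).
by case: (f _) => a b; rewrite ltcE /= => /andP[/eqP -> ->].
Qed.

Lemma circle_symbol_min f : (forall t, analytic_at f (cexpi t)) ->
    (forall z : C, `|z| = 1 -> 0 < f z) ->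
  exists2 mu : R, 0 < mu & forall t, 0 <= t <= 2 * pi -> mu%:C <= f (cexpi t).
Proof.
move=> fa fpos; have pi0 : 0 <= 2 * pi :> R by rewrite mulr_ge0 ?pi_ge0.
have [c _ cmin] := EVT_min pi0 (continuous_subspaceT (circle_symbol_continuous fa)).
exists (complex.Re (f (cexpi c))); first exact: (circle_symbol_real c fpos).2.
move=> t t2; rewrite (circle_symbol_real t fpos).1 lecR; apply: cmin.
by rewrite in_itv.
Qed.

End CircleSymbol.

Section RiemannSum.
Variable R : realType.
Implicit Types (g h : R -> R) (t b e : R).

Lemma uniform_continuity_segment g b e : continuous g -> 0 < e ->
  exists d, 0 < d /\ forall t s, 0 <= t <= b -> `|s - t| <= d -> `|g s - g t| <= e.
Proof.
move=> gc e0; pose Q (N : nat) t :=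
  forall s, `|s - t| <= N.+1%:R^-1 -> `|g s - g t| <= e.
have [|N HN] := @compact_uniform R 0 b Q; last first.
  by exists N.+1%:R^-1; rewrite invr_gt0 ltr0n; split => // t s tb; exact: HN.
move=> t _; have e2 : 0 < e / 2 by rewrite divr_gt0.
have [d [d0 Hd]] := (continuous_ptP g t).1 (gc t) _ e2.
have d2 : 0 < d / 2 by rewrite divr_gt0.
have [N0 N0d] := inv_natS_lt d2; exists (d / 2), N0; split => // N s NN0 st r rs.
have rt : `|r - t| < d.
  have -> : r - t = (r - s) + (s - t) by ring.
  have := ler_normD (r - s) (s - t); have := le_lt_trans rs (N0d N NN0); lra.
have st' : `|s - t| < d by lra.
have -> : g r - g s = (g r - g t) - (g s - g t) by ring.
have := ler_normB (g r - g t) (g s - g t); have := Hd r rt; have := Hd s st'; lra.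
Qed.

Lemma continuous_primitive g b : continuous g -> 0 < b ->
  exists F : R -> R, (forall x, 0 <= x <= b -> is_derive x 1 F (g x)) /\
    \int[lebesgue_measure]_(x in `[0, b]) g x = F b - F 0.
Proof.
move=> gc b0; pose F x := \int[lebesgue_measure]_(t in `[-1, x]) g t.
have gint (x y : R) : lebesgue_measure.-integrable `[x, y] (EFin \o g).
  apply: continuous_compact_integrable; first exact: segment_compact.
  exact: continuous_subspaceT.
exists F; split=> [x /andP[x0 xb]|].
  have x1 : -1 < x by lra.
  have xb1 : x < b + 1 by lra.
  have [dF F'] := continuous_FTC1_closed xb1 (gint (-1) (b + 1)) x1 (gc x).
  exact: (DeriveDef dF (etrans (esym (derive1E F x)) F')).
rewrite /F Rintegral_itvB ?bnd_simp ?(ltW b0) //.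
rewrite -Rintegral_itv_obnd_cbnd //; apply: integrableS (gint 0 b) => //.
by apply: subset_itvr; rewrite bnd_simp.
Qed.

Lemma riemann_sum_cvg g b e : continuous g -> 0 < b -> 0 < e ->
  exists N, forall M, (N <= M)%N -> (0 < M)%N ->
  `|\int[lebesgue_measure]_(x in `[0, b]) g x -
     b / M%:R * \sum_(p < M) g (b * (p%:R / M%:R))| <= e.
Proof.
move=> gc b0 e0; have [F [dF ->]] := continuous_primitive gc b0.
have eb : 0 < e / b by rewrite divr_gt0.
have [d [d0 Hd]] := uniform_continuity_segment b gc eb.
exists (Num.truncn (b / d)).+1 => M NM M0.
have Mr0 : 0 < M%:R :> R by rewrite ltr0n.
set t := fun p : nat => b * (p%:R / M%:R).
have tM : t M = b by rewrite /t divff ?mulr1 // gt_eqF.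
have t0 : t 0%N = 0 by rewrite /t mul0r mulr0.
have dt p : t p.+1 - t p = b / M%:R by rewrite /t -addn1 natrD; ring.
have dt0 : 0 < b / M%:R by rewrite divr_gt0.
have dtd : b / M%:R <= d.
  rewrite ler_pdivrMr // mulrC -ler_pdivrMr //.
  by rewrite (le_trans (ltW (truncnS_gt _))) // ler_nat.
rewrite -{1}tM -{1}t0 -(telescope_sumr (F \o t) (leq0n M)) big_mkord.
rewrite mulr_sumr -sumrB.
apply: le_trans (ler_norm_sum _ _ _) _.
apply: (@le_trans _ _ (\sum_(p < M) e / M%:R)); last first.
  by rewrite sumr_const card_ord -(mulr_natr (e / _)) divfK // gt_eqF.
apply: ler_sum => p _; rewrite /= -/(t p).
have tp : 0 <= t p by rewrite mulr_ge0 ?divr_ge0 ?(ltW b0).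
have tp1 : t p.+1 <= b.
  by rewrite -[leRHS]tM ler_pM2l // ler_pM2r ?invr_gt0 // ler_nat.
have ltp : t p < t p.+1 by rewrite -subr_gt0 dt.
have dFp x : x \in `]t p, t p.+1[ -> is_derive x 1 F (g x).
  by rewrite in_itv /= => /andP[x1 x2]; apply: dF; lra.
have [|c cp ->] := MVT ltp dFp.
  apply: derivable_within_continuous => x; rewrite in_itv /= => /andP[x1 x2].
  by apply: ex_derive; apply: dF; lra.
rewrite dt mulrC -mulrBr normrM gtr0_norm //.
have -> : e / M%:R = b / M%:R * (e / b) by field; rewrite !gt_eqF.
rewrite ler_pM2l //; apply: Hd; first by lra.
move: cp; rewrite in_itv /= => /andP[c1 c2]; have := dt p.
by rewrite ger0_norm; lra.
Qed.

End RiemannSum.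

Section FourierCoefficient.
Variable R : realType.
Local Notation C := R[i].
Implicit Types (f : C -> C) (d : int) (t : R).

Definition fourier f d : C :=
  circle_integral (fun z => z ^ d * f z / (2 * (pi : R)%:C * (0 +i* 1) * z)).

Lemma sum_complex (I : Type) (s : seq I) (a b : I -> R) :
  \sum_(i <- s) (a i +i* b i) = (\sum_(i <- s) a i) +i* (\sum_(i <- s) b i).
Proof. by elim: s => [|i s IH]; rewrite !(big_nil, big_cons) // IH. Qed.

Lemma cabs_le_ReIm (a b : R) : cabs (a +i* b) <= `|a| + `|b|.
Proof.
rewrite -(@ler_pXn2r _ 2) ?nnegrE ?cabs_ge0 ?addr_ge0 // sqr_cabs /= sqrrD.
by rewrite !real_normK ?num_real // lerD2r lerDl mulrn_wge0 // mulr_ge0.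
Qed.

Lemma fourier_dft_cvg f d (e : R) : (forall t, analytic_at f (cexpi t)) ->
    (forall z : C, `|z| = 1 -> 0 < f z) -> 0 < e ->
  exists N, forall M, (N <= M)%N -> (0 < M)%N -> cabs (fourier f d - dft M f d) <= e.
Proof.
move=> fa fpos e0; have pi0 := pi_gt0 R; have pi2 : 0 < 2 * (pi : R) by rewrite mulr_gt0.
pose h t := complex.Re (f (cexpi t)).
have hc : continuous h := circle_symbol_continuous fa.
pose gc t := cos (d%:~R * t) * h t / (2 * pi).
pose gs t := sin (d%:~R * t) * h t / (2 * pi).
have gE t : cexpi t ^ d * f (cexpi t) = (2 * (pi : R))%:C * (gc t +i* gs t).
  rewrite (circle_symbol_real t fpos).1 cexpiXz -/(h t) /cexpi /gc /gs; simpc.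
  by congr (_ +i* _); rewrite [RHS]mulrC divfK // gt_eqF.
have fourierE : fourier f d =
    (\int[lebesgue_measure]_(t in `[0, 2 * pi]) gc t) +i*
    (\int[lebesgue_measure]_(t in `[0, 2 * pi]) gs t).
  have E t : cexpi t ^ d * f (cexpi t) / (2 * (pi : R)%:C * (0 +i* 1) * cexpi t) *
      ((0 +i* 1) * cexpi t) = gc t +i* gs t.
    have i0 : (0 +i* 1 : C) != 0 by rewrite eq_complex /= oner_eq0 andbF.
    have p0 : (pi : R)%:C != 0 by rewrite eq_complex /= (gt_eqF pi0).
    rewrite gE rmorphM /= rmorph_nat; move: (0 +i* 1) (pi%:C) (gc t +i* gs t) i0 p0 => I P w i0 p0.
    by field; rewrite cexpi_neq0 i0 p0.
  by rewrite /fourier /circle_integral /cintegral; congr (_ +i* _);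
    apply: eq_Rintegral => t _; rewrite E.
have dftE M : dft M f d =
    (2 * pi / M%:R * \sum_(p < M) gc (2 * pi * (p%:R / M%:R))) +i*
    (2 * pi / M%:R * \sum_(p < M) gs (2 * pi * (p%:R / M%:R))).
  rewrite /dft; under eq_bigr do rewrite omegaX gE.
  rewrite -mulr_sumr sum_complex mulrA.
  have -> : M%:R^-1 * (2 * pi)%:C = (2 * (pi : R) / M%:R)%:C.
    by rewrite [RHS]rmorphM fmorphV rmorph_nat mulrC.
  by simpc.
have lin_c t : {for t, continuous (fun t => d%:~R * t : R)}.
  by apply: cvgM; [exact: cvg_cst|exact: cvg_id].
have gcc : continuous gc.
  move=> t; apply: cvgM; last exact: cvg_cst.
  apply: cvgM; last exact: hc.
  apply: continuous_comp; [exact: lin_c|exact: continuous_cos].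
have gsc : continuous gs.
  move=> t; apply: cvgM; last exact: cvg_cst.
  apply: cvgM; last exact: hc.
  apply: continuous_comp; [exact: lin_c|exact: continuous_sin].
have e2 : 0 < e / 2 by rewrite divr_gt0.
have [N1 H1] := riemann_sum_cvg gcc pi2 e2.
have [N2 H2] := riemann_sum_cvg gsc pi2 e2.
exists (maxn N1 N2) => M; rewrite geq_max => /andP[M1 M2] M0.
rewrite fourierE dftE; apply: le_trans (cabs_le_ReIm _ _) _.
have := H1 M M1 M0; have := H2 M M2 M0; lra.
Qed.

End FourierCoefficient.

Section DiscreteToeplitz.
Variable R : realType.
Local Notation C := R[i].
Implicit Types (f : C -> C) (d : int) (m n : nat).

Lemma unity_rootsE m : (0 < m)%N ->
  @unity_roots R m = [set` [seq omega R m ^+ p | p <- iota 0 m]]%classic.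
Proof.
move=> m0; apply/seteqP; split => z /=.
  rewrite /unity_roots /= => /(prim_rootP (omega_prim R m0))[i ->].
  by apply: map_f; rewrite mem_iota ltn_ord.
by move=> /mapP[p _ ->]; rewrite /unity_roots /= exprAC omegaXM // expr1n.
Qed.

Lemma fsbig_unity_roots (T : Type) (idx : T) (op : Monoid.com_law idx) m (F : C -> T) :
  (0 < m)%N ->
  \big[op/idx]_(z \in @unity_roots R m) F z = \big[op/idx]_(p < m) F (omega R m ^+ p).
Proof.
move=> m0; rewrite unity_rootsE // -fsbig_seq; last first.
  rewrite map_inj_in_uniq ?iota_uniq // => i j; rewrite !mem_iota /= => im jm.
  by move=> /eqP; rewrite (eq_prim_root_expr (omega_prim R m0)) !modn_small // => /eqP.
by rewrite big_map -{1}[m]subn0 big_mkord.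
Qed.

Lemma card_unity_roots m : (0 < m)%N -> size (finmap.enum_fset (fset_set (@unity_roots R m))) = m.
Proof.
move=> m0; have fin : finite_set (@unity_roots R m).
  by rewrite unity_rootsE //; exact: finite_seq.
rewrite -sum1_size -(fsbig_finite _ (fun=> 1%N)) // fsbig_unity_roots //.
by rewrite sum1_card card_ord.
Qed.

Lemma discrete_toeplitzE m n f : (0 < m)%N ->
  discrete_toeplitz n f (@unity_roots R m) = \det (dft_toeplitz m n f).
Proof.
move=> m0; congr (\det _); apply/matrixP => j k; rewrite !mxE.
by rewrite card_unity_roots // fsbig_unity_roots.
Qed.

Lemma expR_decay_small (a x : R) : 0 < a -> 0 < x ->
  exists N, forall n, (N <= n)%N -> expR (- a) ^+ n <= x.
Proof.
move=> a0 x0; exists (Num.truncn (x^-1 / a)).+1 => n Nn.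
rewrite -expRM_natl mulrN expRN -[leRHS]invrK lef_pV2 ?posrE ?invr_gt0 ?expR_gt0 //.
apply: le_trans (expR_ge1Dx _); have : x^-1 <= n%:R * a; last by lra.
by rewrite -ler_pdivrMr // (le_trans (ltW (truncnS_gt _))) // ler_nat.
Qed.

Lemma fourier_dft_decay f (rho D : R) m d :
    (forall t, analytic_at f (cexpi t)) -> (forall z : C, `|z| = 1 -> 0 < f z) ->
    0 <= rho < 1 -> 0 <= D ->
    (forall M d, (0 < M)%N -> (2 * `|d| <= M)%N -> cabs (dft M f d) <= D * rho ^+ `|d|) ->
    (`|d| < m)%N ->
  cabs (fourier f d - dft m f d) <= 2 * D / (1 - rho) * rho ^+ (m - `|d|).
Proof.
move=> fa fpos rho01 D0 decay dm; apply/ler_addgt0Pr => e e0.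
have [N HN] := fourier_dft_cvg d fa fpos e0.
have mN : (N <= m * N.+1)%N by rewrite (leq_trans (leqnSn N)) // leq_pmull //; lia.
have mN0 : (0 < m * N.+1)%N by rewrite muln_gt0; lia.
have := HN _ mN mN0; have := dft_refine rho01 D0 decay dm (ltn0Sn N).
have -> : fourier f d - dft m f d = (fourier f d - dft (m * N.+1) f d) -
  (dft m f d - dft (m * N.+1) f d) by ring.
have := cabsD (fourier f d - dft (m * N.+1) f d) (- (dft m f d - dft (m * N.+1) f d)).
rewrite cabsN; lra.
Qed.

Lemma toeplitz_perturb f (mu rho D : R) m n :
    (forall t, analytic_at f (cexpi t)) -> (forall z : C, `|z| = 1 -> 0 < f z) ->
    0 < mu -> (forall t, 0 <= t <= 2 * pi -> mu%:C <= f (cexpi t)) ->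
    0 <= rho < 1 -> 0 <= D ->
    (forall M d, (0 < M)%N -> (2 * `|d| <= M)%N -> cabs (dft M f d) <= D * rho ^+ `|d|) ->
    (0 < m)%N -> (n <= m)%N ->
  let A := 4 * D / (1 - rho) ^+ 3 in 8 * A * rho ^+ (m - n) <= mu ->
  toeplitz n f != 0 /\
  cabs (discrete_toeplitz n f (@unity_roots R m) / toeplitz n f - 1) <=
    8 * A / mu * rho ^+ (m - n).
Proof.
move=> fa fpos mu0 fmu rho01 D0 decay m0 nm A Amu.
rewrite discrete_toeplitzE //; set T := dft_toeplitz m n f.
have cT : coercive mu T.
  apply: dft_toeplitz_coercive => // p pm; rewrite omegaX; apply: fmu.
  have pi0 := pi_gt0 R.
  have h0 : (0 : R) <= p%:R / m%:R by rewrite divr_ge0.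
  have h1 : p%:R / m%:R <= 1 :> R by rewrite ler_pdivrMr ?ltr0n // mul1r ler_nat ltnW.
  by apply/andP; split; nra.
pose T' := \matrix_(j < n, k < n) fourier f (- j%:Z + k%:Z).
have rho1 : 0 < 1 - rho by lra.
have SE : \sum_i \sum_j cabs ((T' - T) i j) <= A * rho ^+ (m - n).
  apply: (@le_trans _ _ (2 * D / (1 - rho) *
      \sum_(j < n) \sum_(k < n) rho ^+ (m - `|(- j%:Z + k%:Z)%R|))).
    rewrite mulr_sumr; apply: ler_sum => j _; rewrite mulr_sumr; apply: ler_sum => k _.
    rewrite !mxE; apply: fourier_dft_decay => //.
    by have := ltn_ord j; have := ltn_ord k; lia.
  have -> : A = 2 * D / (1 - rho) * (2 * (1 - rho) ^- 2).
    by rewrite /A; field; rewrite gt_eqF.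
  rewrite -[leRHS]mulrA ler_wpM2l ?sum_toeplitz_geometric_le //.
  by rewrite divr_ge0 ?mulr_ge0 // ltW.
have := det_perturb (E := T' - T) mu0 cT.
rewrite [T + _]addrC subrK -[\det T']/(toeplitz n f) => /(_ ltac:(lra)) H.
have dT0 : 0 < cabs (\det T).
  by rewrite cabs_gt0 -unitfE -unitmxE (coercive_unitmx mu0 cT).
set S := \sum_i _ in SE H.
have {}H : cabs (toeplitz n f - \det T) <= 4 * A / mu * rho ^+ (m - n) * cabs (\det T).
  apply: le_trans H _; rewrite ler_wpM2r ?cabs_ge0 // mulrAC [leRHS]mulrAC.
  rewrite ler_pM2r ?invr_gt0 //; lra.
set sg := 4 * A / mu * rho ^+ (m - n) in H.
have sg12 : sg <= 1 / 2.
  have -> : sg = (4 * A * rho ^+ (m - n)) / mu by rewrite /sg; ring.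
  by rewrite ler_pdivrMr //; lra.
have dT'_ge : cabs (\det T) <= 2 * cabs (toeplitz n f).
  have := cabsB_ge (\det T) (toeplitz n f - \det T).
  rewrite [\det T + _]addrC subrK; nra.
have dT'0 : toeplitz n f != 0 by rewrite -cabs_gt0; lra.
split => //.
have -> : \det T / toeplitz n f - 1 = - (toeplitz n f - \det T) / toeplitz n f.
  by field.
rewrite cabsM cabsV cabsN ler_pdivrMr ?cabs_gt0 //.
have -> : 8 * A / mu * rho ^+ (m - n) = 2 * sg by rewrite /sg; ring.
have sg0 : 0 <= sg.
  by have := le_trans (cabs_ge0 _) H; rewrite pmulr_lge0.
nra.
Qed.

End DiscreteToeplitz.
Unset Implicit Arguments.
Set Strict Implicit.

Theorem corollary1p1 (R : realType) (f : R[i] -> R[i])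
    (f_analytic : analytic_near f (@unit_circle R))
    (f_pos : forall z : R[i], `|z| = 1 -> 0 < f z) :
  exists c : R, 0 < c /\
  exists (eps : nat -> nat -> R[i]) (K : R) (N : nat),
  forall n m : nat, (N <= n)%N -> (n + N <= m)%N ->
    discrete_toeplitz n f (@unity_roots R m) = toeplitz n f * (1 + eps n m) /\
    `|eps n m| <= (K * expR (- (c * (m%:R - n%:R))))%:C.
Proof.
have fa t : analytic_at f (cexpi t).
  have [U [_ cU fU]] := f_analytic; apply: fU; apply: cU.
  by rewrite /unit_circle /= normcabs cabs_cexpi.
have [delta [B [delta0 B0 fP]]] := analytic_local_approx fa.
have [mu mu0 fmu] := circle_symbol_min fa f_pos.
pose k := maxn 8 (Num.truncn (6 / delta)).+1.
have k8 : (8 <= k)%N by rewrite leq_maxl.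
have kd : 6 <= k%:R * delta.
  by rewrite -ler_pdivrMr // (le_trans (ltW (truncnS_gt _))) // ler_nat leq_maxr.
have k0 : 0 < k%:R^-1 :> R by rewrite invr_gt0 ltr0n (leq_trans _ k8).
set rho := expR (- k%:R^-1) : R.
have rho01 : 0 <= rho < 1 by rewrite expR_ge0 /= expR_lt1 oppr_lt0.
have D0 : 0 <= 4 * B by rewrite mulr_ge0.
have decay M d : (0 < M)%N -> (2 * `|d| <= M)%N -> cabs (dft M f d) <= 4 * B * rho ^+ `|d|.
  by move=> M0 dM; exact: dft_decay fP B0 k8 kd M0 dM.
pose A := 4 * (4 * B) / (1 - rho) ^+ 3.
have A0 : 0 <= A by rewrite divr_ge0 ?exprn_ge0 ?mulr_ge0 //; lra.
have [|N HN] := @expR_decay_small R k%:R^-1 (mu / (8 * A + 1)) k0.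
  by rewrite divr_gt0 //; lra.
exists k%:R^-1; split => //.
exists (fun n m => discrete_toeplitz n f (@unity_roots R m) / toeplitz n f - 1).
exists (8 * A / mu), N.+1 => n m _ nNm.
have m0 : (0 < m)%N by rewrite (leq_trans _ nNm) // addnS.
have nm : (n <= m)%N := leq_trans (leq_addr _ _) nNm.
have small : 8 * A * rho ^+ (m - n) <= mu.
  have /HN : (N <= m - n)%N by rewrite leq_subRL // (leq_trans _ nNm) // leq_add2l.
  rewrite -/rho ler_pdivlMr; last by lra.
  have : 0 <= rho ^+ (m - n) by rewrite exprn_ge0 ?expR_ge0.
  lra.
have [T0 le_eps] := toeplitz_perturb fa f_pos mu0 fmu rho01 D0 decay m0 nm small.
split; first by rewrite [1 + _]addrC subrK mulrC divfK.
rewrite normcabs lecR (le_trans le_eps) // ler_wpM2l //.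
  by rewrite divr_ge0 ?(ltW mu0) // mulr_ge0.
by rewrite -natrB // /rho -expRM_natl mulrN (mulrC _ k%:R^-1).
Qed.
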